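(* Let $x>0$ be a real number, $d\ge 1$ an integer, and $r$ a nonzero real number with $r^2\neq x$. Let $g(t)=\frac{1}{t^2-x}$ and let $\{\mathcal{H}_n\}_{n\ge 0}$ be the sequence of Householder's method of order $d$ for $\sqrt{x}$ with starting point $r$: $$\mathcal{H}_0=r,\qquad \mathcal{H}_{n+1}=\mathcal{H}_n+d\,\frac{g^{(d-1)}(\mathcal{H}_n)}{g^{(d)}(\mathcal{H}_n)}\quad(n\ge 0).$$ Then for every integer $n\ge 0$, $$\mathcal{H}_n=\sqrt{x}\,\frac{(r+\sqrt{x})^{(d+1)^n}+(r-\sqrt{x})^{(d+1)^n}}{(r+\sqrt{x})^{(d+1)^n}-(r-\sqrt{x})^{(d+1)^n}},$$ and, as a rational function of $(x,r)$, $$\mathcal{H}_n=r\,\frac{\displaystyle\sum_{k=0}^{\left\lceil\frac{(d+1)^n-1}{2}\right\rceil}\binom{(d+1)^n}{2k}x^k r^{(d+1)^n-2k}}{\displaystyle\sum_{k=0}^{\left\lfloor\frac{(d+1)^n-1}{2}\right\rfloor}\binom{(d+1)^n}{1+2k}x^k r^{(d+1)^n-2k}}.$$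
   Context: $g^{(m)}$ denotes the $m$-th derivative of $g$, with $g^{(0)}=g$. *)

(* Defs.v *)
From HB Require Import structures.
From mathcomp Require Import all_boot all_order all_algebra.
From mathcomp Require Import all_classical all_reals all_analysis.
Import Order.TTheory GRing.Theory Num.Theory.
Import numFieldNormedType.Exports.

Set Implicit Arguments.
Unset Strict Implicit.
Unset Printing Implicit Defensive.

Local Open Scope ring_scope.

Definition recip_quad (R : realType) (x : R) : R -> R :=
  fun t => 1 / (t ^+ 2 - x).

(* Both the iterated derivative [derive1n] and the division are total in the
   libraries: a step from [t] is a genuine Householder step when
   [t ^+ 2 != x] (so that g is smooth near t) and [derive1n d (recip_quad x) t != 0]. *)
Fixpoint householder (R : realType) (x : R) (d : nat) (r : R) (n : nat) : R :=
  if n is m.+1 then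
    let h := householder x d r m in
    h + d%:R * (derive1n d.-1 (recip_quad x) h / derive1n d (recip_quad x) h)
  else r.

(* Main.v *)
Require Import Defs.
From HB Require Import structures.
From mathcomp Require Import all_boot all_order all_algebra.
From mathcomp Require Import all_classical all_reals all_analysis.
From mathcomp Require Import ring lra zify.
Import Order.TTheory GRing.Theory Num.Theory.
Import numFieldNormedType.Exports.
Local Open Scope ring_scope.

(** Write [s] for the square root of [x].  Partial fractions turn
    [1 / (t^2 - x)] into [((t - s)^-1 - (t + s)^-1) / (2 s)], so that its [m]-th
    derivative is, up to an explicit constant,
    [(t - s)^-(m+1) - (t + s)^-(m+1)] ([derive1n_recip_quad]).  In the quotient
    of two consecutive derivatives the constants reduce to [- 1 / d], and a
    Householder step becomes the rational map
    [t |-> s (a^(d+1) + b^(d+1)) / (a^(d+1) - b^(d+1))] with [a = t + s] and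
    [b = t - s] ([householder_step]).

    This map is homogeneous of degree 0 in [(a, b)]: it depends only on the
    ratio [a : b].  If [t = s (p + q) / (p - q)], that ratio is [p : q]; hence in
    the coordinate [p : q] the step is [p : q |-> p^(d+1) : q^(d+1)]
    ([householder_step_ratio]).  Starting from [r + s : r - s], iteration raises
    both terms to the power [N = (d+1)^n] ([householder_ratio]).

    No denominator vanishes because [r + s] and [r - s] are nonzero
    ([r^2 != x]) and have distinct absolute values ([r] and [s] are nonzero);
    both properties are inherited by powers.

    The polynomial form comes from grouping the binomial expansion of
    [(r + s)^N] by the parity of the exponent of [s] ([exprD_parity]): if
    [(r + s)^N = E + s O] then [(r - s)^N = E - s O], and the quotient of the
    sum by the difference is [E / (s O)]. *)

(** * Derivatives of the reciprocal of a quadratic *)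

Lemma is_derive_subXN (R : realType) (c t : R) (k : nat) : t != c ->
  is_derive t 1 (fun u : R => (u - c) ^- k) (- k%:R * (t - c) ^- k.+1).
Proof.
move=> tc; have tc0 : t - c != 0 by rewrite subr_eq0.
have dX : is_derive t 1 (fun u : R => (u - c) ^+ k) (k%:R * (t - c) ^+ k.-1).
  have -> : (fun u : R => (u - c) ^+ k) = (id - cst c) ^+ k.
    by apply/funext => u; rewrite exprfctE.
  by apply: is_derive_eq; rewrite subr0 [LHS]mulr1.
pose f := fun u : R => (u - c) ^+ k.
have ft0 : f t != 0 by rewrite expf_neq0.
have df : derivable f t 1 by exact: ex_derive.
apply: DeriveDef; first exact: (derivableV (f := f)).
rewrite (deriveV (f := f)) // derive_val /f /GRing.scale /=.
case: k {dX f ft0 df} => [|k]; first by rewrite !mul0r mulr0 oppr0 mul0r.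
rewrite /= [(t - c) ^+ k.+2]exprS [(t - c) ^+ k.+1]exprS -natr1.
by field; rewrite ?expf_neq0 ?tc0.
Qed.

(** Writing the constant term of the quadratic as [s ^+ 2] makes the two simple
    poles [s] and [- s] explicit; each partial fraction is then differentiated
    separately.  The formula for order [m] holds on an open set avoiding the
    poles, hence near [t], so it may be differentiated at [t]. *)
Lemma derive1n_recip_quad (R : realType) (s t : R) (m : nat) :
  s != 0 -> t != s -> t != - s ->
  derive1n m (recip_quad (s ^+ 2)) t =
  (-1) ^+ m * m`!%:R / (2 * s) * ((t - s) ^- m.+1 - (t + s) ^- m.+1).
Proof.
move=> s0; elim: m t => [|m IHm] t ts tNs.
  have ? : t - s != 0 by rewrite subr_eq0.
  have ? : t + s != 0 by rewrite addr_eq0.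
  rewrite derive1n0 /recip_quad !expr1 fact0 expr0 mulr1 subr_sqr.
  by field; apply/and3P.
rewrite derive1nS derive1E.
pose K : R := (-1) ^+ m * m`!%:R / (2 * s).
pose F := fun u : R => K * ((u - s) ^- m.+1 - (u - - s) ^- m.+1).
have nearF : \near t, derive1n m (recip_quad (s ^+ 2)) t = F t.
  have near_neq (c : R) : t != c -> \forall u \near t, u != c.
    by move=> tc; apply: open_nbhs_nbhs; split=> //; exact: open_neq.
  apply: filterS2 (near_neq _ ts) (near_neq _ tNs) => u us uNs.
  by rewrite IHm // /F opprK.
rewrite (near_eq_derive _ nearF).
have d1 := @is_derive_subXN _ _ _ m.+1 ts.
have d2 := @is_derive_subXN _ _ _ m.+1 tNs.
have -> : F = K \*: ((fun u : R => (u - s) ^- m.+1)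
                     - (fun u : R => (u - - s) ^- m.+1)) by [].
rewrite derive_val /GRing.scale /= /K opprK factS natrM [(-1) ^+ m.+1]exprS.
ring.
Qed.

(** * Binomial expansion by parity *)

Lemma sum_parity (V : nmodType) (f : nat -> V) (n : nat) :
  \sum_(0 <= i < n) f i =
  \sum_(0 <= k < uphalf n) f (2 * k)%N + \sum_(0 <= k < n./2) f (1 + 2 * k)%N.
Proof.
elim: n => [|n IHn]; first by rewrite !big_geq // addr0.
rewrite big_nat_recr //= IHn uphalf_half.
have := odd_double_half n; case: (odd n) => /= nE.
  rewrite add1n [X in _ = _ + X]big_nat_recr //= addrA.
  by rewrite mul2n -[in f n]nE.
rewrite add0n [X in _ = X + _]big_nat_recr //= addrAC.
by rewrite mul2n -[in f n]nE.
Qed.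

(** Only even powers of [s] remain in either sum, so both are unchanged when [s]
    is replaced by [- s]. *)
Lemma exprD_parity (R : comPzRingType) (r s : R) (N : nat) : (0 < N)%N ->
  (r + s) ^+ N =
  \sum_(0 <= k < (uphalf (N - 1)).+1)
     ('C(N, 2 * k))%:R * (s ^+ 2) ^+ k * r ^+ (N - 2 * k) +
  s * \sum_(0 <= k < ((N - 1)./2).+1)
     ('C(N, 1 + 2 * k))%:R * (s ^+ 2) ^+ k * r ^+ (N - (1 + 2 * k)).
Proof.
case: N => // N _; rewrite subn1 exprDn -(big_mkord predT
  (fun i => (r ^+ (N.+1 - i) * s ^+ i) *+ 'C(N.+1, i))) /= sum_parity /=.
congr (_ + _); last rewrite mulr_sumr; apply: eq_bigr => k _.
  by rewrite exprM -[LHS]mulr_natl [r ^+ _ * _]mulrC mulrA.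
by rewrite exprD exprM -mulr_natl; ring.
Qed.

(** * A Householder step as a power map *)

Lemma normr_exp_neq (R : numDomainType) (a b : R) (n : nat) : (0 < n)%N ->
  `|a| != `|b| -> `|a ^+ n| != `|b ^+ n|.
Proof. by move=> n0; rewrite !normrX eqrXn2. Qed.

(** With [a = t + s] and [b = t - s] the step equals
    [(a + b) / 2 - a b (a^d - b^d) / (a^(d+1) - b^(d+1))]; since
    [s = (a - b) / 2], the conclusion is an identity between rational functions
    of [a] and [b].  The hypothesis on powers says exactly that the [d]-th
    derivative does not vanish at [t]. *)
Lemma householder_step (R : realType) (s t : R) (d : nat) : (0 < d)%N ->
  s != 0 -> t != s -> t != - s -> (t + s) ^+ d.+1 != (t - s) ^+ d.+1 ->
  derive1n d (recip_quad (s ^+ 2)) t != 0 /\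
  t + d%:R * (derive1n d.-1 (recip_quad (s ^+ 2)) t /
              derive1n d (recip_quad (s ^+ 2)) t) =
  s * (((t + s) ^+ d.+1 + (t - s) ^+ d.+1) /
       ((t + s) ^+ d.+1 - (t - s) ^+ d.+1)).
Proof.
case: d => // d _ s0 ts tNs dN.
have b0 : t - s != 0 by rewrite subr_eq0.
have a0 : t + s != 0 by rewrite addr_eq0.
rewrite [d.+1.-1]/= !derive1n_recip_quad //.
have fd : (d`!%:R : R) != 0 by rewrite pnatr_eq0 -lt0n fact_gt0.
have d1 : (d.+1%:R : R) != 0 by rewrite pnatr_eq0.
have e0 : (-1) ^+ d != 0 :> R by rewrite signr_eq0.
set a := t + s in a0 dN *; set b := t - s in b0 dN *.
have tE : t = (a + b) / 2 by rewrite /a /b; field.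
have sE : s = (a - b) / 2 by rewrite /a /b; field.
have ab0 : a ^+ d.+2 - b ^+ d.+2 != 0 by rewrite subr_eq0.
split.
  apply: mulf_neq0.
    rewrite !mulf_neq0 ?invr_eq0 ?mulf_neq0 ?signr_eq0 ?pnatr_eq0 //.
    by rewrite -lt0n fact_gt0.
  by rewrite subr_eq0 (inj_eq invr_inj) eq_sym.
have A0 : a ^+ d.+1 != 0 by rewrite expf_neq0.
have B0 : b ^+ d.+1 != 0 by rewrite expf_neq0.
rewrite factS natrM [(-1) ^+ d.+1]exprS.
move: ab0; rewrite [a ^+ d.+2]exprS [b ^+ d.+2]exprS => ab0.
rewrite [X in X + _]tE [X in _ = X * _]sE.
(* The identity only uses [a ^+ d.+2 = a * a ^+ d.+1], likewise for [b], so the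
   remaining powers and the constants may be treated as independent variables. *)
move: (a ^+ d.+1) (b ^+ d.+1) A0 B0 ab0 => A B A0 B0 ab0.
move: ((-1) ^+ d) (d`!%:R) (d.+1%:R) fd d1 e0 => e f n f0 n0 e0.
field.
by rewrite ab0 A0 a0 B0 b0 s0 f0 n0 e0.
Qed.

(** The hypothesis on [t] means that [t + s] and [t - s] are proportional to [p]
    and [q], with common factor [2 s / (p - q)]; by homogeneity that factor
    disappears from the formula of [householder_step].  Distinct absolute
    values, unlike mere distinctness, survive raising to a power, which is what
    allows the step to be iterated. *)
Lemma householder_step_ratio (R : realType) (s p q t : R) (d : nat) :
  (0 < d)%N -> s != 0 -> p != 0 -> q != 0 -> `|p| != `|q| ->
  t = s * ((p + q) / (p - q)) ->
  [/\ t ^+ 2 != s ^+ 2, derive1n d (recip_quad (s ^+ 2)) t != 0 &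
   t + d%:R * (derive1n d.-1 (recip_quad (s ^+ 2)) t /
               derive1n d (recip_quad (s ^+ 2)) t) =
   s * ((p ^+ d.+1 + q ^+ d.+1) / (p ^+ d.+1 - q ^+ d.+1))].
Proof.
move=> d0 s0 p0 q0 pq tE.
have pq0 : p - q != 0 by rewrite subr_eq0; apply: contraNneq pq => ->.
pose c := 2 * s / (p - q).
have c0 : c != 0 by rewrite !mulf_neq0 ?invr_eq0 ?pnatr_eq0.
have tDs : t + s = c * p by rewrite tE /c; field.
have tBs : t - s = c * q by rewrite tE /c; field.
clearbody c.
have ts : t != s by rewrite -subr_eq0 tBs mulf_neq0.
have tNs : t != - s by rewrite -addr_eq0 tDs mulf_neq0.
have pqX : p ^+ d.+1 - q ^+ d.+1 != 0.
  rewrite subr_eq0.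
  by apply: contraNneq (normr_exp_neq _ _ _ _ (ltn0Sn d) pq) => ->.
have cX : c ^+ d.+1 != 0 by rewrite expf_neq0.
have [] := householder_step _ s t d d0 s0 ts tNs _.
  by rewrite tDs tBs !exprMn -subr_eq0 -mulrBr mulf_neq0.
move=> dt0 ->; split=> //; first by rewrite eqf_sqr negb_or ts.
rewrite tDs tBs !exprMn -mulrDr -mulrBr; congr (_ * _).
by rewrite -mulf_div divff // mul1r.
Qed.

(** The case [n = 0] holds because [(r + s) + (r - s) = 2 r] and
    [(r + s) - (r - s) = 2 s]; then each step raises both terms of the ratio to
    the power [d + 1]. *)
Lemma householder_ratio (R : realType) (s r : R) (d n : nat) :
  let N := (d.+1 ^ n)%N in
  (0 < d)%N -> s != 0 -> r + s != 0 -> r - s != 0 -> `|r + s| != `|r - s| ->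
  householder (s ^+ 2) d r n =
  s * (((r + s) ^+ N + (r - s) ^+ N) / ((r + s) ^+ N - (r - s) ^+ N)).
Proof.
move=> /= d0 s0 a0 b0 ab; elim: n => [|n IHn].
  rewrite /= expn0 !expr1; field; rewrite subr_eq0.
  by apply: contraNneq ab => ->.
rewrite expnSr !exprM.
have N0 : (0 < d.+1 ^ n)%N by rewrite expn_gt0.
by have [] := householder_step_ratio _ _ _ _ _ _ d0 s0 (expf_neq0 _ a0)
  (expf_neq0 _ b0) (normr_exp_neq _ _ _ _ N0 ab) IHn.
Qed.

(** * The closed forms *)

Theorem theorem11 (R : realType) (x : R) (d : nat) (r : R)
    (hx : 0 < x) (hd : (1 <= d)%N) (hr : r != 0) (hrx : r ^+ 2 != x) :
  forall n : nat,
    let H := householder x d r n in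
    let N := ((d + 1) ^ n)%N in
    let s := Num.sqrt x in
    let num := \sum_(0 <= k < (uphalf (N - 1)).+1)
                 ('C(N, 2 * k))%:R * x ^+ k * r ^+ (N - 2 * k) in
    let den := \sum_(0 <= k < ((N - 1)./2).+1)
                 ('C(N, 1 + 2 * k))%:R * x ^+ k * r ^+ (N - 2 * k) in
    (H ^+ 2 != x /\ derive1n d (recip_quad x) H != 0) /\
    ((r + s) ^+ N - (r - s) ^+ N != 0 /\
     H = s * (((r + s) ^+ N + (r - s) ^+ N) /
              ((r + s) ^+ N - (r - s) ^+ N))) /\
    (den != 0 /\ H = r * (num / den)).
Proof.
move=> n H N s num den.
have s0 : s != 0 by rewrite gt_eqF // sqrtr_gt0.
have xE : x = s ^+ 2 by rewrite sqr_sqrtr // ltW.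
have [a0 b0] : r + s != 0 /\ r - s != 0.
  by move: hrx; rewrite xE -subr_eq0 subr_sqr mulf_eq0 negb_or => /andP[].
have ab : `|r + s| != `|r - s|.
  rewrite eqr_norm2 negb_or opprB; apply/andP; split.
    by apply: contraNneq s0 => e; apply/eqP; lra.
  by apply: contraNneq hr => e; apply/eqP; lra.
have N0 : (0 < N)%N by rewrite expn_gt0 addn1.
have HE : H = s * (((r + s) ^+ N + (r - s) ^+ N) /
                   ((r + s) ^+ N - (r - s) ^+ N)).
  by rewrite /H /N xE addn1; apply: householder_ratio.
have abX := normr_exp_neq _ _ _ _ N0 ab.
have pq0 : (r + s) ^+ N - (r - s) ^+ N != 0.
  by rewrite subr_eq0; apply: contraNneq abX => ->.
have [H2 dH _] := householder_step_ratio _ _ _ _ _ _ hd s0 (expf_neq0 _ a0)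
  (expf_neq0 _ b0) abX HE.
rewrite -xE in H2 dH.
pose odd_part := \sum_(0 <= k < ((N - 1)./2).+1)
   ('C(N, 1 + 2 * k))%:R * x ^+ k * r ^+ (N - (1 + 2 * k)).
have pE : (r + s) ^+ N = num + s * odd_part.
  by rewrite /num /odd_part xE exprD_parity.
have qE : (r - s) ^+ N = num - s * odd_part.
  by rewrite /num /odd_part xE exprD_parity // sqrrN mulNr.
have denE : den = r * odd_part.
  rewrite /den /odd_part mulr_sumr; apply: eq_big_nat => k /andP[_ kN].
  (* The range of [k] gives [1 + 2 * k <= N]: no subtraction is truncated. *)
  have -> : (N - 2 * k = (N - (1 + 2 * k)).+1)%N by lia.
  by rewrite exprS mulrCA.
have o0 : odd_part != 0.
  apply: contraNneq pq0 => o0.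
  by rewrite pE qE o0 mulr0 addr0 subr0 subrr.
do 2!split=> //; split=> //; first by rewrite denE mulf_neq0.
rewrite HE denE pE qE; by field; rewrite o0 hr -pE -qE.
Qed.
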